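(* Let $G$ be a metabelian group with an abelian normal subgroup $A \le G$ such that the quotient group $B = G/A$ is finitely generated abelian. Suppose that the group $G$ has Krull dimension $K(G) \le 1$. Then $G$ satisfies the weak minimal condition for normal subgroups $Min-\infty-N$.
   Context: Deviation of a poset $\Omega$: for $a\ge b$ in $\Omega$ put $a/b=\{x\in\Omega \mid b\le x\le a\}$. If $\Omega$ is trivial (no two distinct elements are comparable), $\operatorname{dev}\Omega=-1$. If $\Omega$ is nontrivial and satisfies the minimal condition, $\operatorname{dev}\Omega=0$. For a general ordinal $\beta$, $\operatorname{dev}\Omega=\beta$ if $\operatorname{dev}\Omega\neq\alpha$ for all $\alpha<\beta$ and, in any descending chain $\{a_i\}$ of elements of $\Omega$, all but finitely many factors $a_i/a_{i+1}$ have deviation less than $\beta$. (The deviation need not exist.) The Krull dimension $K(G)$ of a group $G$ is the deviation of the poset of all normal subgroups of $G$ ordered by inclusion, if it exists. A group $G$ satisfies $Min-\infty-N$ if for every infinite descending chain $H_1\ge H_2\ge\cdots$ of normal subgroups of $G$ the index $|H_i:H_{i+1}|$ is finite for all but finitely many $i$. *)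

(* Defs.v *)
From HB Require Import structures.
From mathcomp Require Import all_boot all_order.
From mathcomp Require Import boolp classical_sets functions cardinality.

Set Implicit Arguments.
Unset Strict Implicit.
Unset Printing Implicit Defensive.

Local Open Scope classical_set_scope.
Local Open Scope group_scope.
Local Open Scope quotient_scope.

Section Deviation.
Context {dP : Order.disp_t} {P : porderType dP}.

Definition factor (Om : set P) (a b : P) : set P :=
  [set x | Om x /\ (b <= x <= a)%O].

Definition trivial_poset (Om : set P) : Prop :=
  forall x y : P, Om x -> Om y -> (x <= y)%O -> x = y.

Definition minimal_condition (Om : set P) : Prop :=
  forall S : set P, S `<=` Om -> S !=set0 ->
    exists2 m, S m & forall x, S x -> (x <= m)%O -> x = m.

Definition descending_chain (Om : set P) (a : nat -> P) : Prop :=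
  (forall i, Om (a i)) /\ (forall i, (a i.+1 <= a i)%O).

(* The condition "dev Om = b" depends only on the order type of the ordinals
   below b, so ordinals are taken in an arbitrary well-ordered type W; the value
   -1 is adjoined to W as None. *)
Context {dW : Order.disp_t} {W : orderType dW}.
Hypothesis W_wf : well_founded (fun a b : W => (a < b)%O).

Definition deviation_step (b : W)
    (dev : forall a : W, (a < b)%O -> set P -> Prop) (Om : set P) : Prop :=
  ((forall a : W, (b <= a)%O) /\ ~ trivial_poset Om /\ minimal_condition Om) \/
  ((exists a : W, (a < b)%O) /\
   ~ trivial_poset Om /\
   (forall (a : W) (ltab : (a < b)%O), ~ dev a ltab Om) /\
   (forall c : nat -> P, descending_chain Om c ->
      finite_set [set i | ~ (trivial_poset (factor Om (c i) (c i.+1)) \/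
        exists (a : W) (ltab : (a < b)%O),
          dev a ltab (factor Om (c i) (c i.+1)))])).

Definition deviation (d : option W) (Om : set P) : Prop :=
  if d is Some b then Fix W_wf (fun=> set P -> Prop) deviation_step b Om
  else trivial_poset Om.

Definition ext_lt (d e : option W) : Prop :=
  match d, e with
  | None, Some _ => True
  | Some a, Some b => (a < b)%O
  | _, None => False
  end.

Definition ext_le (d e : option W) : Prop := d = e \/ ext_lt d e.

Lemma deviationE (b : W) (Om : set P) :
  deviation (Some b) Om <->
  ((forall a : W, (b <= a)%O) /\ ~ trivial_poset Om /\ minimal_condition Om) \/
  ((exists a : W, (a < b)%O) /\
   (forall d, ext_lt d (Some b) -> ~ deviation d Om) /\
   (forall c : nat -> P, descending_chain Om c ->
      finite_set [set i | ~ exists2 d, ext_lt d (Some b) &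
        deviation d (factor Om (c i) (c i.+1))])).
Proof.
rewrite {1}/deviation Fix_eq; last first.
  move=> x f g fg; suff -> : f = g by [].
  by apply: functional_extensionality_dep => a; apply: funext => h; exact: fg.
rewrite {1}/deviation_step.
have step O' : (trivial_poset O' \/ exists (a : W) (_ : (a < b)%O),
      Fix W_wf (fun=> set P -> Prop) deviation_step a O') <->
    (exists2 d, ext_lt d (Some b) & deviation d O').
  split=> [[?|[a [ab ?]]]|[[a|] //= ab ?]].
  - by exists None.
  - by exists (Some a).
  - by right; exists a, ab.
  - by left.
have E c : [set i | ~ (trivial_poset (factor Om (c i) (c i.+1)) \/
        exists (a : W) (_ : (a < b)%O),
          Fix W_wf (fun=> set P -> Prop) deviation_step a
            (factor Om (c i) (c i.+1)))] =
    [set i | ~ exists2 d, ext_lt d (Some b) &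
        deviation d (factor Om (c i) (c i.+1))].
  by apply/seteqP; split=> i /= h /step.
split=> [[?|[h0 [h1 [h2 h3]]]]|[?|[h0 [h1 h2]]]]; [by left|right|by left|right].
  split=> //; split=> [[a|] //= ab|c hc]; first exact: h2.
  by rewrite -E; exact: h3.
split=> //; split; first exact: (h1 None).
split=> [a ab|c hc]; first exact: (h1 (Some a)).
by rewrite E; exact: h2.
Qed.

End Deviation.

Lemma nat_wf : well_founded (fun a b : nat => (a < b)%O).
Proof. by elim/ltn_ind => n IH; constructor=> m /IH. Qed.

Section Groups.
Variable G : groupType.
Implicit Types H K N : set G.

Definition subgroup H : Prop := H 1 /\ forall x y, H x -> H y -> H (x / y).

Definition normal_subgroup N : Prop :=
  subgroup N /\ forall x y, N x -> N (x ^ y).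

Definition abelian H : Prop := forall x y, H x -> H y -> commute x y.

Definition generated (S : set G) : set G := smallest subgroup S.

Definition finitely_generated : Prop :=
  exists s : seq G, generated [set` s] = [set: G].

Definition derived_subgroup : set G :=
  generated [set z | exists x y : G, z = [~ x, y]].

Definition metabelian : Prop := abelian derived_subgroup.

Definition finite_index H K : Prop :=
  finite_set [set [set h * k | k in K] | h in H].

Definition weak_min_normal : Prop :=
  forall H : nat -> set G,
    (forall i, normal_subgroup (H i)) -> (forall i, H i.+1 `<=` H i) ->
    finite_set [set i | ~ finite_index (H i) (H i.+1)].

(* The sets of elements are ordered by inclusion in set G. Finite ordinals
   suffice to express a bound on K(G) by a natural number. *)
Definition krull_dimension (d : option nat) : Prop :=
  deviation nat_wf d [set N : set G | normal_subgroup N].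

Definition krull_dimension_le (n : nat) : Prop :=
  exists2 d, krull_dimension d & ext_le d (Some n).

End Groups.

Section QuotientGroup.
Variables (G : groupType) (A : set G) (nA : normal_subgroup A).

Let A1 : A 1. Proof. by case: nA => -[]. Qed.
Let AF x y : A x -> A y -> A (x / y). Proof. by case: nA => -[_ +] _; apply. Qed.
Let AV x : A x -> A x^-1. Proof. by move=> ?; rewrite -div1g; exact: AF. Qed.
Let AM x y : A x -> A y -> A (x * y).
Proof. by move=> ? /AV ?; rewrite -[y]invgK; exact: AF. Qed.
Let AJ x y : A x -> A (x ^ y). Proof. by case: nA => _; apply. Qed.

Definition coset_rel of normal_subgroup A :=
  fun x y : G => `[< A (x^-1 * y) >].

Lemma coset_rel_equiv : equiv_class_of (coset_rel nA).
Proof.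
split=> [x|x y|y x z]; rewrite /coset_rel.
- by rewrite mulVg; apply/asboolP.
- by apply/asboolP/asboolP => /AV; rewrite invgM invgK.
- move=> /asboolP xy /asboolP yz; apply/asboolP.
  by have := AM xy yz; rewrite -mulgA mulVKg.
Qed.

Canonical coset_equivRel := EquivRelPack coset_rel_equiv.
Canonical coset_encModRel := defaultEncModRel (coset_rel nA).

Definition quotient_group := {eq_quot coset_equivRel}.
HB.instance Definition _ := Choice.on quotient_group.
HB.instance Definition _ := EqQuotient.on quotient_group.

Definition quot_proj (x : G) : quotient_group := \pi x.

Lemma quot_projP (x y : G) : quot_proj x = quot_proj y <-> A (x^-1 * y).
Proof. by split=> [/eqquotP/asboolP|?]; last by apply/eqquotP/asboolP. Qed.

Lemma quot_reprK : cancel repr quot_proj.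
Proof. by move=> a; rewrite /quot_proj reprK. Qed.

Lemma quot_reprP (x : G) : A ((repr (quot_proj x))^-1 * x).
Proof. by apply/quot_projP; rewrite quot_reprK. Qed.

Definition quot_one : quotient_group := quot_proj 1.
Definition quot_mul (a b : quotient_group) : quotient_group :=
  quot_proj (repr a * repr b).
Definition quot_inv (a : quotient_group) : quotient_group :=
  quot_proj (repr a)^-1.

Lemma quot_mulE (x y : G) :
  quot_mul (quot_proj x) (quot_proj y) = quot_proj (x * y).
Proof.
have rx := quot_reprP x; have ry := quot_reprP y.
apply/quot_projP; set r := repr _ in rx *; set s := repr _ in ry *.
rewrite (_ : _ * _ = (s^-1 * y) * (r^-1 * x) ^ y); first exact: AM ry (AJ _ rx).
by rewrite conjgE invgM !mulgA mulgK.
Qed.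

Lemma quot_invE (x : G) : quot_inv (quot_proj x) = quot_proj x^-1.
Proof.
have rx := quot_reprP x; apply/quot_projP; set r := repr _ in rx *.
rewrite (_ : _ * _ = (r^-1 * x)^-1 ^ r^-1); first exact/AJ/AV.
by rewrite conjgE invgM !invgK mulgK.
Qed.

Lemma quot_mulA : associative quot_mul.
Proof.
move=> a b c; rewrite -[a]quot_reprK -[b]quot_reprK -[c]quot_reprK.
by rewrite ![quot_mul (quot_proj _) (quot_proj _)]quot_mulE mulgA.
Qed.

Lemma quot_mul1 : left_id quot_one quot_mul.
Proof. by move=> a; rewrite -[a]quot_reprK quot_mulE mul1g. Qed.

Lemma quot_mulr1 : right_id quot_one quot_mul.
Proof. by move=> a; rewrite -[a]quot_reprK quot_mulE mulg1. Qed.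

Lemma quot_mulV : left_inverse quot_one quot_inv quot_mul.
Proof. by move=> a; rewrite -[a]quot_reprK quot_invE quot_mulE mulVg. Qed.

Lemma quot_mulrV : right_inverse quot_one quot_inv quot_mul.
Proof. by move=> a; rewrite -[a]quot_reprK quot_invE quot_mulE mulgV. Qed.

HB.instance Definition _ := isGroup.Build quotient_group
  quot_mulA quot_mul1 quot_mulr1 quot_mulV quot_mulrV.

End QuotientGroup.

(* Main.v *)
From HB Require Import structures.
Require Import Defs.
From mathcomp Require Import all_boot all_order all_algebra.
From mathcomp Require Import finfield zify ring.
From mathcomp Require Import boolp classical_sets functions cardinality.

(* Intersecting with A and projecting to B = G/A reduces the theorem to a chain
   of submodules of a module M over a finitely generated commutative ring R (the
   ring of operators generated on A by conjugation, respectively the prime ring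
   for B), whose factors are Artinian from some point on.

   A cyclic Artinian R-module is finite: among the infinite modules Rfx choose a
   minimal one; the g for which Rgfx is finite form a maximal ideal, which has
   finite residue field by the Nullstellensatz over the integers, hence is
   finitely generated, and so Rfx is finite after all.

   If infinitely many factors of the chain were infinite, then after passing to a
   subchain M_0 > M_1 > ... with all factors Artinian and infinite there would be
   x_k in M_k outside Y_k = Rx_0 + ... + Rx_(k-1) + M_(k+1), since the image of
   the finitely generated part in M/M_(k+1) is finite. Modulo the sum of the
   submodules (Rx_k) /\ Y_k, the x_k generate an infinite direct sum, and an
   infinite direct sum has a descending chain all of whose factors are again
   infinite direct sums, contradicting K(G) <= 1. *)

Set Implicit Arguments.
Unset Strict Implicit.
Unset Printing Implicit Defensive.

Import Order.TTheory GRing.Theory Num.Theory.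
Local Open Scope classical_set_scope.
Local Open Scope quotient_scope.
Local Open Scope ring_scope.

(** * The Nullstellensatz over the integers *)

Definition subring_set (R : pzRingType) (S : set R) : Prop :=
  [/\ S 1, forall a b, S a -> S b -> S (a - b)
    & forall a b, S a -> S b -> S (a * b)].

Definition ring_generated (R : pzRingType) (xs : seq R) : Prop :=
  forall S : set R, subring_set S -> (forall x, x \in xs -> S x) ->
    forall a, S a.

(* The condition on [c] says that [c] is not invertible in [R[1/a]]. *)
Definition no_field_localization (R : idomainType) : Prop :=
  forall a : R, a != 0 ->
    exists2 c : R, c != 0 & forall r k, c * r <> a ^+ k.

(** Modulo [c] the product [t * a] is [1], hence so is [(t * a) ^+ k]; but [c] divides this power,
    so [c] divides [1]. *)
Lemma unit_dvd_expr (R : idomainType) (a t c : R) r k :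
  c = 1 - t * a -> c * r = a ^+ k -> c \is a GRing.unit.
Proof.
move=> cE cr; apply/unitrPr.
have [s sE] : exists s, (t * a) ^+ k = 1 - c * s.
  have -> : t * a = 1 - c by rewrite cE opprB addrC subrK.
  elim: k {cr} => [|k [s IH]]; first by exists 0; rewrite mulr0 subr0.
  exists (1 + s - c * s); rewrite exprS IH mulrBl mul1r !mulrBr mulrDr !mulr1.
  rewrite mulrA !opprD !opprK !addrA; congr (_ + _).
  by rewrite -!addrA; congr (_ + _); rewrite addrC.
exists (r * t ^+ k + s).
by rewrite mulrDr mulrA cr -exprMn [a * t]mulrC sE subrK.
Qed.

Lemma int_no_field_localization : no_field_localization int.
Proof.
(* The factor 3 keeps [1 - 3 * a] away from [0], [1] and [-1] for every nonzero [a]. *)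
move=> a a0; exists (1 - 3%:Z * a) => [|r k /(unit_dvd_expr erefl)]; last first.
  by move: a0 => /eqP a0 /orP[] /eqP; lia.
by lia.
Qed.

Lemma poly_no_field_localization (R : idomainType) :
  no_field_localization {poly R}.
Proof.
move=> f f0; have sz : size (1 - 'X * f) = (size f).+1.
  rewrite addrC size_polyDl size_polyN mulrC size_mulX // size_poly1 ltnS.
  by rewrite size_poly_gt0.
exists (1 - 'X * f) => [|r k /(unit_dvd_expr erefl)].
  by rewrite -size_poly_gt0 sz.
by rewrite poly_unitE sz eqSS size_poly_eq0 (negPf f0).
Qed.

Section Nullstellensatz.
Variable D : fieldType.

(** With [a] the leading coefficient and [n.+1] the degree, multiplying [p(x) = 0] by [a ^+ n] gives
    a monic equation for [a * x], that of the polynomial [q] below. *)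
Lemma integral_lead_coefM (R : idomainType) (phi : {rmorphism R -> D})
    (p : {poly R}) (x : D) :
  injective phi -> p != 0 -> root (map_poly phi p) x ->
  integralOver phi (phi (lead_coef p) * x).
Proof.
move=> phi_inj p0 /rootP px; set a := lead_coef p.
have [n szp] : exists n, size p = n.+1.
  by exists (size p).-1; rewrite prednK // size_poly_gt0.
case: n szp => [|n] szp.
  move: px; rewrite -[p]coefK szp poly_def big_ord1 expr0 alg_polyC.
  rewrite map_polyC hornerC => /eqP; rewrite (_ : p`_0 = a); last first.
    by rewrite /a lead_coefE szp.
  by move=> /eqP ->; rewrite mul0r; exact: integral0.
have an : p`_n.+1 = a by rewrite /a lead_coefE szp.
pose q := \poly_(i < n.+2) (if i == n.+1 then 1 else p`_i * a ^+ (n - i)).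
have qm : q \is monic.
  rewrite monicE lead_coef_poly ?eqxx ?oner_eq0 //.
exists q => //; apply/rootP.
rewrite horner_coef size_map_poly_id0; last by rewrite (monicP qm) rmorph1 oner_eq0.
rewrite size_poly_eq ?eqxx ?oner_eq0 //.
transitivity (phi a ^+ n * (map_poly phi p).[x]); last by rewrite px mulr0.
rewrite horner_coef size_map_inj_poly ?rmorph0 //.
rewrite szp mulr_sumr; apply: eq_bigr => i _.
rewrite !coef_map /= coef_poly ltn_ord exprMn.
have := ltn_ord i; rewrite ltnS leq_eqVlt.
case: eqP => [-> _|_ /= ltin]; first by rewrite an rmorph1 mul1r exprSr mulrA.
rewrite rmorphM rmorphXn !mulrA; congr (_ * _).
by rewrite -mulrA -exprD subnK // mulrC.
Qed.

Lemma integral_common_multiple (R : idomainType) (phi : {rmorphism R -> D})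
    (xs : seq D) :
  injective phi ->
  (forall x, x \in xs -> exists2 p : {poly R}, p != 0 & root (map_poly phi p) x) ->
  exists2 a : R, a != 0 & forall x, x \in xs -> integralOver phi (phi a * x).
Proof.
move=> phi_inj; elim: xs => [|x xs IH] alg; first by exists 1; rewrite ?oner_eq0.
have [|a a0 intxs] := IH; first by move=> y yxs; apply: alg; rewrite inE yxs orbT.
have [p p0 px] := alg x (mem_head _ _).
exists (lead_coef p * a) => [|y]; first by rewrite mulf_neq0 ?lead_coef_eq0.
rewrite inE => /orP[/eqP->|yxs]; rewrite rmorphM.
  rewrite mulrAC; apply: integral_mul; last exact: integral_id.
  exact: integral_lead_coefM.
by rewrite -mulrA; apply: integral_mul; [exact: integral_id|exact: intxs].
Qed.

(** Multiplying a monic equation of degree [n] for [b / c] by [c ^+ n] leaves a factor [c] in every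
    term but [b ^+ n]. *)
Lemma integral_inv_dvd (R : idomainType) (phi : {rmorphism R -> D}) (b c : R) :
  injective phi -> c != 0 -> integralOver phi (phi b / phi c) ->
  exists r m, c * r = b ^+ m.
Proof.
move=> phi_inj c0 [p pm /rootP].
have c0' : phi c != 0 by rewrite -(rmorph0 phi) (inj_eq phi_inj).
have [n szp] : exists n, size p = n.+1.
  by exists (size p).-1; rewrite prednK // size_poly_gt0 monic_neq0.
have pn : p`_n = 1 by have /monicP := pm; rewrite lead_coefE szp.
rewrite horner_coef size_map_inj_poly ?rmorph0 // szp big_ord_recr /=.
rewrite coef_map /= pn rmorph1 mul1r => /(congr1 ( *%R (phi c ^+ n))).
rewrite mulr0 mulrDr expr_div_n mulrCA divff ?expf_neq0 // mulr1 mulr_sumr.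
pose r := \sum_(i < n) p`_i * b ^+ i * c ^+ (n - i.+1).
rewrite (_ : \sum_(i < n) _ = phi (c * r)); last first.
  rewrite mulr_sumr rmorph_sum; apply: eq_bigr => i _.
  rewrite coef_map !rmorphM !rmorphXn /= expr_div_n.
  have -> : phi c ^+ n = phi c * phi c ^+ (n - i.+1) * phi c ^+ i.
    by rewrite mulrAC -exprS -exprD subnKC.
  rewrite [_ / phi c ^+ i]mulrC mulrCA !mulrA.
  have ci : phi c ^+ i != 0 by rewrite expf_neq0.
  by field.
rewrite -rmorphXn -rmorphD -[X in _ = X](rmorph0 phi) => /phi_inj /eqP.
rewrite addrC addr_eq0 => /eqP bE; exists (- r), n.
by rewrite bE mulrN.
Qed.

(** With [a] a common multiplier that makes the generators integral, the [d] for which some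
    [a ^+ k * d] is integral form a subring. If this were all of [D], it would contain [1 / c], and
    [c] would divide a power of [a]. *)
Lemma algebraic_not_generating (R : idomainType) (phi : {rmorphism R -> D})
    (xs : seq D) :
  injective phi -> no_field_localization R ->
  (forall x, x \in xs -> exists2 p : {poly R}, p != 0 & root (map_poly phi p) x) ->
  ~ (forall S : set D, subring_set S -> (forall r, S (phi r)) ->
       (forall x, x \in xs -> S x) -> forall d, S d).
Proof.
move=> phi_inj nR alg gen.
have [a a0 intxs] := integral_common_multiple phi_inj alg.
have [c c0 /= cP] := nR a a0.
suff [k /integral_inv_dvd[|//|r [m]]] :
    exists k, integralOver phi (phi (a ^+ k) / phi c).
  - by [].
  - by rewrite -exprM => /cP.
apply: (gen [set d | exists k, integralOver phi (phi (a ^+ k) * d)]).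
- split=> [|d e [k dk] [l el]|d e [k dk] [l el]].
  + by exists 0; rewrite expr0 rmorph1 mul1r; exact: integral1.
  + exists (k + l)%N; rewrite mulrBr exprD rmorphM.
    apply: integral_sub; [rewrite mulrAC mulrC|rewrite -mulrA];
      by apply: integral_mul => //; exact: integral_id.
  + by exists (k + l)%N; rewrite exprD rmorphM mulrACA; exact: integral_mul.
- by move=> r; exists 0; rewrite expr0 rmorph1 mul1r; exact: integral_id.
- by move=> x xxs; exists 1; rewrite expr1; exact: intxs.
Qed.

(* Munshi's induction: a generator that is transcendental over [R] is absorbed
   into the ring of coefficients; when all of them are algebraic, the inverse of
   any [c] is integral over a localization of [R], so that [c] divides a power
   of a fixed element. *)
Lemma no_field_localization_not_generating n (R : idomainType)
    (phi : {rmorphism R -> D}) (xs : seq D) :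
  size xs = n -> injective phi -> no_field_localization R ->
  ~ (forall S : set D, subring_set S -> (forall r, S (phi r)) ->
       (forall x, x \in xs -> S x) -> forall d, S d).
Proof.
elim: n R phi xs => [|n IH] R phi xs szxs phi_inj nR gen.
  apply: algebraic_not_generating phi_inj nR _ gen => x.
  by rewrite (size0nil szxs).
apply: (algebraic_not_generating phi_inj nR _ gen) => x xxs.
apply: contrapT => /forall2NP trx.
pose cx : commr_rmorph phi x := fun a => mulrC x (phi a).
have psi_inj : injective (horner_morph cx).
  apply: raddf_inj => p /eqP; rewrite /horner_morph /= => px.
  by have [/negP|[]//] := trx p; rewrite negbK => /eqP.
apply: (IH {poly R} (horner_morph cx) (rem x xs)) => //.
- by rewrite size_rem // szxs.
- exact: poly_no_field_localization.
- move=> S subS Sphi Sxs; apply: gen => // [r|y yxs].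
    by have := Sphi r%:P; rewrite /= horner_morphC.
  have [->|yx] := eqVneq y x; first by have := Sphi 'X; rewrite /= horner_morphX.
  by apply: Sxs; move: yxs; rewrite (perm_mem (perm_to_rem xxs)) inE (negPf yx).
Qed.

(** [T] consists of the polynomials in [x] of degree below [d] with coefficients in [S]. As the
    equation for [x] has integer coefficients, an additive group [S] is enough for stability under
    [x]. The last clause preserves stability under the generators adjoined earlier. *)
Lemma finite_adjoin_integral (S : set D) (x : D) (d : nat)
    (c : nat -> int) :
  finite_set S -> S 1 -> (forall a b, S a -> S b -> S (a - b)) ->
  x ^+ d = \sum_(i < d) (c i)%:~R * x ^+ i ->
  exists T : set D, [/\ finite_set T, T 1,
    forall a b, T a -> T b -> T (a - b), forall a, T a -> T (x * a)
    & forall y, (forall a, S a -> S (y * a)) -> forall a, T a -> T (y * a)].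
Proof.
move=> finS S1 SB xd.
have S0 : S 0 by rewrite -(subrr 1); exact: SB.
have SN a : S a -> S (- a) by move=> Sa; rewrite -sub0r; exact: SB.
have SD a b : S a -> S b -> S (a + b).
  by move=> Sa Sb; rewrite -[b]opprK; apply: SB => //; exact: SN.
have SM a n : S a -> S (a *+ n).
  by move=> Sa; elim: n => [|n IH]; rewrite ?mulr0n// mulrS; exact: SD.
have SZ a n : S a -> S (n%:~R * a).
  move=> Sa; rewrite mulrzl; case: n => n; first exact: SM.
  by rewrite NegzE mulrNz; apply: SN; exact: SM.
pose T k : set D :=
  [set u | exists2 f : nat -> D, forall i, S (f i) & u = \sum_(i < k) f i * x ^+ i].
have finT k : finite_set (T k).
  elim: k => [|k IH].
    apply: (@sub_finite_set _ _ [set 0]) => [u [f _ ->]|]; last exact: finite_set1.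
    by rewrite big_ord0.
  apply: sub_finite_set (finite_image2 (fun s t => s + t * x) finS IH).
  move=> u [f Sf ->]; exists (f 0) => //.
  exists (\sum_(i < k) f i.+1 * x ^+ i); first by exists (fun i => f i.+1).
  rewrite big_ord_recl expr0 mulr1 mulr_suml; congr (_ + _).
  by apply: eq_bigr => i _; rewrite /= exprSr mulrA.
have d0 : (0 < d)%N.
  by case: d xd {T finT} => //; rewrite big_ord0 expr0 => /eqP; rewrite oner_eq0.
exists (T d); split=> //.
- exists (fun i => (i == 0)%:R) => [i|]; first by case: eqP.
  case: d d0 {xd finT} => // d _; rewrite big_ord_recl expr0 mulr1 big1 ?addr0 //.
  by move=> i _; rewrite /= mul0r.
- move=> a b [f Sf ->] [g Sg ->]; exists (fun i => f i - g i) => [i|].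
    exact: SB.
  by rewrite -sumrB; apply: eq_bigr => i _; rewrite mulrBl.
- move=> _ [f Sf ->].
  case: d d0 xd {finT} => // d _ xd.
  exists (fun i => (if i is j.+1 then f j else 0) + (c i)%:~R * f d) => [i|].
    by apply: SD; [case: i|exact: SZ].
  rewrite big_ord_recr /= mulrDr mulrCA -exprS xd.
  under [RHS]eq_bigr => i _ do rewrite mulrDl.
  rewrite big_split /=; congr (_ + _).
    rewrite big_ord_recl mul0r add0r mulr_sumr; apply: eq_bigr => i _.
    by rewrite mulrCA -exprS.
  by rewrite mulr_sumr; apply: eq_bigr => i _; rewrite mulrA [f d * _]mulrC.
- move=> y yS _ [f Sf ->]; exists (fun i => y * f i) => [i|]; first exact: yS.
  by rewrite mulr_sumr; apply: eq_bigr => i _; rewrite mulrA.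
Qed.

Lemma finitely_generated_field_finite (xs : seq D) :
  ring_generated xs -> finite_set [set: D].
Proof.
move=> gen.
(* In characteristic zero the integers embed in [D] and would be a base ring of the excluded
   kind. *)
have [[p pchar_p]|nchar] := pselect (exists p, p \in [pchar D]); last first.
  exfalso; apply: (@no_field_localization_not_generating _ int intr xs erefl).
  - apply: raddf_inj => -[[//|n] m0|n m0]; exfalso; apply: nchar.
      by apply: (@natf0_pchar _ n.+1) => //; apply/eqP.
    have m0' : - n.+1%:R = 0 :> D := m0.
    by apply: (@natf0_pchar _ n.+1) => //; rewrite -oppr_eq0 m0'.
  - exact: int_no_field_localization.
  - by move=> S subS _ Sxs; exact: gen.
have [phi phiE] : exists phi : {rmorphism 'F_p -> D},
    forall c, phi c = (val c)%:Z%:~R.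
  exists (GRing.in_alg (pPrimeCharType pchar_p)
            : {rmorphism 'F_p -> pPrimeCharType pchar_p}) => c.
  exact: mulr1.
(* A transcendental generator would embed a polynomial ring over ['F_p] in [D], again an excluded
   base ring. *)
have alg x : x \in xs -> integralOver phi x.
  move=> xxs; apply/integral_algebraic; apply: contrapT => /forall2NP trx.
  pose cx : commr_rmorph phi x := fun a => mulrC x (phi a).
  have psi_inj : injective (horner_morph cx).
    apply: raddf_inj => q /eqP; rewrite /horner_morph /= => qx.
    by have [/negP|[]//] := trx q; rewrite negbK => /eqP.
  apply: (@no_field_localization_not_generating _ {poly 'F_p} _ xs erefl psi_inj).
    exact: poly_no_field_localization.
  by move=> S subS _ Sxs; exact: gen.
(* The multipliers of [T] form a subring containing [xs], hence all of [D]; since [T] contains [1],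
   it is then all of [D]. *)
suff [T [finT T1 TB Txs]] : exists T : set D, [/\ finite_set T, T 1,
    forall a b, T a -> T b -> T (a - b)
    & forall x a, x \in xs -> T a -> T (x * a)].
  apply: sub_finite_set finT => a _; rewrite -[a]mulr1.
  apply: (gen [set a | forall b, T b -> T (a * b)]) => // [|x xxs b]; last exact: Txs.
  split=> [b|b c Sb Sc d Td|b c Sb Sc d Td]; first by rewrite mul1r.
  - by rewrite mulrBl; apply: TB; [exact: Sb|exact: Sc].
  - by rewrite -mulrA; apply/Sb/Sc.
elim: xs alg {gen} => [|x xs IH] alg.
  exists [set phi c | c in [set: 'F_p]]; split=> //.
  - by apply: finite_image; exact: finite_finset.
  - by exists 1; rewrite ?rmorph1.
  - by move=> _ _ [a _ <-] [b _ <-]; exists (a - b); rewrite ?rmorphB.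
have [T [finT T1 TB Txs]] := IH (fun y yxs => alg y (@mem_behead _ (x :: xs) y yxs)).
have [q qm /rootP] := alg x (mem_head _ _).
have [n szq] : exists n, size q = n.+1.
  by exists (size q).-1; rewrite prednK // size_poly_gt0 monic_neq0.
have qn : q`_n = 1 by have /monicP := qm; rewrite lead_coefE szq.
rewrite horner_coef size_map_poly szq big_ord_recr /= coef_map /= qn rmorph1 mul1r.
move/eqP; rewrite addrC addr_eq0 -sumrN => /eqP xn.
have [|T' [finT' T'1 T'B T'x T'y]] := @finite_adjoin_integral T x n
  (fun i => - (val q`_i)%:Z) finT T1 TB.
  rewrite xn; apply: eq_bigr => i _.
  by rewrite coef_map /= phiE mulrNz mulNr.
exists T'; split=> // y a; rewrite inE => /orP[/eqP->|yxs]; first exact: T'x.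
by apply: T'y => b; exact: Txs.
Qed.

End Nullstellensatz.

(** * Cyclic Artinian modules *)

Definition submod (R : pzRingType) (M : lmodType R) (N : set M) : Prop :=
  N 0 /\ forall a u v, N u -> N v -> N (a *: u + v).

(** This is finiteness of the image of [N] in [V / L]; the representatives may lie outside [N]. *)
Definition finite_mod (V : zmodType) (L N : set V) : Prop :=
  exists s : seq V, forall u, N u -> exists2 t, t \in s & L (u - t).

Section FiniteQuotients.
Variable R : comNzRingType.

Section MaximalIdeal.
Variable P : set R.
Hypotheses (P0 : P 0) (PMD : forall a u v, P u -> P v -> P (a * u + v)).
Hypothesis P1 : ~ P 1.

Definition pred_of_ideal of P 0 & ~ P 1 &
    (forall a u v, P u -> P v -> P (a * u + v)) : {pred R} := [pred a | `[<P a>]].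
Local Notation I := (pred_of_ideal P0 P1 PMD).

Lemma pred_of_idealE a : (a \in I) = `[<P a>]. Proof. by []. Qed.

Lemma pred_of_ideal_closed : idealr_closed I.
Proof.
split=> [||a u v]; rewrite ?pred_of_idealE; first exact/asboolP.
  by apply/asboolP.
by move=> /asboolP Pu /asboolP Pv; apply/asboolP/PMD.
Qed.

HB.instance Definition _ := isIdealr.Build R I pred_of_ideal_closed.

Lemma ideal_quotP (a b : R) : \pi_{ideal_quot I} a = \pi b <-> P (a - b).
Proof.
split=> [/eqP|Pab]; last apply/eqP.
  by rewrite -Quotient.idealrBE => /asboolP.
by rewrite -Quotient.idealrBE; apply/asboolP.
Qed.

(** Inverses modulo [P] make the residue ring a field; it is generated by the images of [xs], hence
    finite. *)
Lemma maximal_ideal_finite (xs : seq R) :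
  ring_generated xs -> (forall g, ~ P g -> exists h, P (g * h - 1)) ->
  finite_mod P setT.
Proof.
move=> gen Pmax.
pose Q := {ideal_quot I}.
have invQ (d : Q) : exists e : Q, d != 0 -> e * d = 1.
  have [->|d0] := eqVneq d 0; first by exists 0.
  elim/quotW: d d0 => a a0.
  have [|h Ph] := Pmax a.
    move=> Pa; move/eqP: a0; apply; rewrite (_ : 0 = \pi_Q 0) ?piE//; apply/ideal_quotP.
    by rewrite subr0.
  exists (\pi h) => _; rewrite (_ : 1 = \pi_Q 1) ?piE//; apply/ideal_quotP.
  by rewrite mulrC.
pose inv (d : Q) := if d == 0 then 0 else xget 0 [set e : Q | e * d = 1].
have mulVQ (d : Q) : d != 0 -> inv d * d = 1.
  move=> d0; rewrite /inv (negPf d0).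
  by case: xgetP => [e _ //|no]; have [e /(_ d0)/no] := invQ d.
have inv0 : inv 0 = 0 by rewrite /inv eqxx.
pose F : fieldType := HB.pack Q (GRing.ComNzRing_isField.Build Q mulVQ inv0).
have genF : @ring_generated F (map (\pi_Q) xs).
  move=> S [S1 SB SM] Sxs a; elim/quotW: a.
  apply: (gen [set a | S (\pi a)]) => [|x xxs]; last exact/Sxs/map_f.
  split=> [|a b Sa Sb|a b Sa Sb] /=.
  - by rewrite rmorph1.
  - by rewrite rmorphB; exact: SB.
  - by rewrite rmorphM; exact: SM.
have /finite_seqP[s sE] := finitely_generated_field_finite genF.
exists (map repr s) => a _.
exists (repr (\pi_Q a)); last by apply/ideal_quotP; rewrite reprK.
by apply: map_f; have : [set: F] (\pi_Q a) by []; rewrite sE.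
Qed.

End MaximalIdeal.

(** * Submodules and finiteness modulo a submodule *)

Section Submodules.
Variable M : lmodType R.
Implicit Types (L N : set M) (x : M).

Lemma submodD N u v : submod N -> N u -> N v -> N (u + v).
Proof. by move=> [_ NL] Nu Nv; rewrite -[u]scale1r; exact: NL. Qed.

Lemma submodZ N a u : submod N -> N u -> N (a *: u).
Proof. by move=> [N0 NL] Nu; rewrite -[_ *: _]addr0; exact: NL. Qed.

Lemma submodN N u : submod N -> N u -> N (- u).
Proof. by move=> sN Nu; rewrite -scaleN1r; exact: submodZ. Qed.

Lemma submodB N u v : submod N -> N u -> N v -> N (u - v).
Proof. by move=> sN Nu Nv; apply: submodD => //; exact: submodN. Qed.

Lemma submod_sum N (I : Type) (r : seq I) (Q : pred I) (F : I -> M) :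
  submod N -> (forall i, Q i -> N (F i)) -> N (\sum_(i <- r | Q i) F i).
Proof. by move=> sN NF; elim/big_ind: _ => //; [case: sN|move=> u v; exact: submodD]. Qed.

Definition line x : set M := range (fun r : R => r *: x).

Definition add_set L N : set M := [set u + v | u in L & v in N].

Lemma submod_line x : submod (line x).
Proof.
split; first by exists 0; rewrite ?scale0r.
by move=> a _ _ [r _ <-] [q _ <-]; exists (a * r + q); rewrite // scalerDl scalerA.
Qed.

Lemma submod_add_set L N : submod L -> submod N -> submod (add_set L N).
Proof.
move=> [L0 LL] [N0 NL]; split; first by exists 0 => //; exists 0 => //; rewrite addr0.
move=> a _ _ [u Lu [v Nv <-]] [u' Lu' [v' Nv' <-]].
exists (a *: u + u'); first exact: LL.
by exists (a *: v + v'); [exact: NL|rewrite scalerDr addrACA].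
Qed.

Lemma finite_modS L N N' : N' `<=` N -> finite_mod L N -> finite_mod L N'.
Proof. by move=> N'N [s sP]; exists s => u /N'N /sP. Qed.

Lemma finite_mod_sub L N : N `<=` L -> finite_mod L N.
Proof.
by move=> NL; exists [:: 0] => u /NL Lu; exists 0; rewrite ?mem_head ?subr0.
Qed.

Lemma finite_modD L N N' : submod L ->
  finite_mod L N -> finite_mod L N' -> finite_mod L (add_set N N').
Proof.
move=> sL [s sP] [s' s'P]; exists [seq t + t' | t <- s, t' <- s'].
move=> _ [u /sP [t ts Lt] [v /s'P [t' ts' Lt'] <-]].
exists (t + t'); first exact: allpairs_f.
by rewrite opprD addrACA; exact: submodD.
Qed.

Fixpoint span (gs : seq M) : set M :=
  if gs is g :: gs' then [set u | exists r : R, span gs' (u - r *: g)]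
  else [set 0].

Lemma submod_span gs : submod (span gs).
Proof.
elim: gs => [|g gs [IH0 IHL]]; first by split=> // a _ _ -> ->; rewrite scaler0 addr0.
split; first by exists 0; rewrite scale0r subr0.
move=> a u v [r ur] [q vq]; exists (a * r + q).
have := IHL a _ _ ur vq; congr (span gs _).
by rewrite scalerBr scalerDl scalerA addrACA opprD.
Qed.

Lemma span_cons g gs : span gs `<=` span (g :: gs).
Proof. by move=> u gu; exists 0; rewrite scale0r subr0. Qed.

Lemma mem_span gs g : g \in gs -> span gs g.
Proof.
elim: gs => // h gs IH; rewrite inE => /orP[/eqP->|/IH]; last exact: span_cons.
by exists 1; rewrite scale1r subrr; case: (submod_span gs).
Qed.

Lemma span_sub gs N : submod N -> (forall g, g \in gs -> N g) -> span gs `<=` N.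
Proof.
move=> sN; elim: gs => [|g gs IH] gsN u; first by move=> ->; case: sN.
move=> [r /IH ur]; rewrite -[u](subrK (r *: g)); apply: submodD => //.
  by apply: ur => h hgs; apply: gsN; rewrite inE hgs orbT.
by apply: submodZ => //; apply: gsN; rewrite mem_head.
Qed.

Lemma finite_mod_span L gs : submod L ->
  (forall g, g \in gs -> finite_mod L (line g)) -> finite_mod L (span gs).
Proof.
move=> sL; elim: gs => [|g gs IH] fg.
  by apply: finite_mod_sub => _ ->; case: sL.
apply: (@finite_modS _ (add_set (line g) (span gs))) => [u [r ur]|].
  by exists (r *: g); [exists r|exists (u - r *: g); rewrite // addrC subrK].
apply: finite_modD => //; first by apply: fg; rewrite mem_head.
by apply: IH => h hgs; apply: fg; rewrite inE hgs orbT.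
Qed.

End Submodules.

Variables (xs : seq R) (gen : ring_generated xs).

(* With [T] a transversal of the ideal [P], the elements [u - t] of [P] with [t]
   in [T] and [u] a generator, a difference or a product of elements of [T]
   suffice. *)
Lemma finite_index_ideal_fg (P : set R^o) :
  submod P -> finite_mod P setT -> exists2 gs : seq R^o,
    (forall g, g \in gs -> P g) & P `<=` span gs.
Proof.
move=> sP [T TP].
pose us : seq R^o := (1 :: xs) ++ [seq t - t' | t <- T, t' <- T]
  ++ [seq (t : R) * t' | t <- T, t' <- T].
pose gs : seq R^o := [seq g <- T ++ [seq u - t | u <- us, t <- T] | `[<P g>]].
have gsP g : g \in gs -> P g by rewrite mem_filter => /andP[/asboolP].
have sgs := submod_span gs.
have usT u : u \in us -> exists2 t, t \in T & span gs (u - t).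
  move=> uus; have [t tT Put] := TP u I; exists t => //; apply: mem_span.
  rewrite mem_filter mem_cat; apply/andP; split; first exact/asboolP.
  by apply/orP; right; exact: allpairs_f.
exists gs => // a Pa.
(* The elements congruent to a member of [T] modulo [span gs] form a subring containing [xs]. *)
have [t tT at_] : exists2 t, t \in T & span gs (a - t).
  move: a {Pa}; apply: gen => [|x xxs]; last first.
    by apply: usT; rewrite inE mem_cat xxs !orbT.
  split=> [|a b [t tT at_] [t' tT' bt']|a b [t tT at_] [t' tT' bt']].
  - by apply: usT; rewrite mem_head.
  - have [|q qT tq] := usT (t - t').
      rewrite mem_cat; apply/orP; right; rewrite mem_cat; apply/orP; left.
      exact: allpairs_f.
    exists q => //; have := submodD sgs (submodB sgs at_ bt') tq.
    by congr (span gs _); ring.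
  - have [|q qT tq] := usT ((t : R) * t').
      rewrite mem_cat; apply/orP; right; rewrite mem_cat; apply/orP; right.
      exact: (allpairs_f (fun t t' : R => t * t')).
    exists q => //.
    have := submodD sgs (submodD sgs (submodZ b sgs at_) (submodZ t sgs bt')) tq.
    by congr (span gs _); rewrite /GRing.scale /=; ring.
(* As [a] and [a - t] lie in [P], so does [t], and the members of [T] in [P] are themselves listed
   in [gs]. *)
rewrite -[a](subrK t); apply: submodD => //; apply: mem_span.
rewrite mem_filter mem_cat tT andbT; apply/asboolP.
rewrite (_ : t = a - (a - t)); first by apply: submodB => //; exact: (span_sub sP gsP).
by rewrite opprB addrC subrK.
Qed.

Variable M : lmodType R.
Implicit Types (L U : set M) (x : M).

(** [P x] is spanned by finitely many [g *: x] with [g] in [P], each generating a finite module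
    modulo [L], and finitely many translates of [P x] cover the line of [x]. *)
Lemma finite_mod_line L x (P : set R^o) :
  submod L -> submod P -> finite_mod P setT ->
  (forall g, P g -> finite_mod L (line (g *: x))) -> finite_mod L (line x).
Proof.
move=> sL sP finP fg; have [gs gsP Pgs] := finite_index_ideal_fg sP finP.
have spanx : [set a *: x | a in span gs] `<=` span [seq g *: x | g <- gs].
  move=> _ [a + <-]; elim: (gs) a => [|g gs' IH] a /=; first by move->; exact: scale0r.
  by move=> [r /IH agx]; exists r; rewrite scalerA -scalerBl.
have [T TP] := finP.
have finT : finite_mod L [set t *: x | t in [set` T]].
  exists [seq t *: x | t <- T] => _ [t tT <-]; exists (t *: x); first exact: map_f.
  by rewrite subrr; case: sL.
apply: finite_modS (finite_modD sL finT
  (finite_mod_span (gs := [seq g *: x | g <- gs]) sL _)).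
  move=> _ [r _ <-]; have [t tT /Pgs rt] := TP r I.
  exists (t *: x); first by exists t.
  exists ((r - t) *: x); last by rewrite -scalerDl addrC subrK.
  by apply: spanx; exists (r - t).
by move=> _ /mapP[g /gsP /fg ? ->].
Qed.

Lemma artinian_line_finite U L x :
  submod U -> submod L -> L `<=` U -> U x ->
  minimal_condition (factor [set N : set M | submod N] U L) ->
  finite_mod L (line x).
Proof.
move=> sU sL LU Ux minUL; apply: contrapT => infx.
pose W f := add_set L (line (f *: x)).
have [||N [f inff NE] Nmin] := minUL [set N | exists2 f : R,
    ~ finite_mod L (line (f *: x)) & N = W f].
- move=> _ [f _ ->]; split; first by apply: submod_add_set => //; exact: submod_line.
  apply/andP; split; rewrite subsetEset.
    by move=> u Lu; exists u => //; exists 0; rewrite ?addr0//; exists 0; rewrite ?scale0r.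
  move=> _ [u /LU Uu [_ [r _ <-] <-]].
  by apply: submodD => //; do 2?apply: submodZ.
- by exists (W 1), 1; rewrite ?scale1r.
pose P : set R^o := [set g | finite_mod L (line (g *: (f *: x)))].
have sP : submod P.
  split; first by apply: finite_mod_sub => _ [r _ <-]; rewrite scale0r scaler0; case: sL.
  move=> a g h Pg Ph; apply: finite_modS (finite_modD sL Pg Ph) => _ [r _ <-].
  exists ((r * a) *: (g *: (f *: x))); first by exists (r * a).
  exists (r *: (h *: (f *: x))); first by exists r.
  by rewrite scalerDl scalerDr !scalerA mulrA.
have P1 : ~ P 1 by rewrite /P /= scale1r.
have Pmax g : ~ P g -> exists h, P (g * h - 1).
  (* By minimality, [g f x] generates the same submodule as [f x] modulo [L]. Hence [f x] is
     congruent to some [r g f x], and [g r - 1] annihilates it modulo [L]. *)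
  move=> Pg; have WE : W (g * f) = W f.
    rewrite -NE; apply: Nmin; first by exists (g * f); rewrite // -scalerA.
    rewrite NE subsetEset => _ [u Lu [_ [r _ <-] <-]].
    exists u => //; exists (r *: ((g * f) *: x)) => //.
    by exists (r * g); rewrite // !scalerA mulrA.
  have : W f (f *: x).
    by exists 0; [case: sL|exists (f *: x); rewrite ?add0r//; exists 1; rewrite ?scale1r].
  rewrite -WE => -[u Lu [_ [r _ <-] ufx]]; exists r.
  apply: finite_mod_sub => _ [q _ <-]; apply: submodZ => //.
  rewrite scalerBl scale1r -{2}ufx scalerA opprD addrCA [g * r]mulrC -mulrA.
  by rewrite -scalerA subrr addr0; exact: submodN.
case: sP => P0 PMD.
apply: inff; apply: (@finite_mod_line L (f *: x) P) => //.
exact: (maximal_ideal_finite P0 PMD P1 gen Pmax).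
Qed.

End FiniteQuotients.

(** * Chains of submodules with Artinian factors *)

Lemma finite_nat_bound (A : set nat) :
  finite_set A -> exists m, forall i, (m <= i)%N -> ~ A i.
Proof.
move=> /finite_seqP[s ->]; exists (\max_(i <- s) i).+1 => i mi /=.
by move=> si; move: mi; rewrite ltnNge (leq_bigmax_seq i si).
Qed.

Section ArtinianFactors.
Variables (R : comNzRingType) (xs : seq R) (gen : ring_generated xs).
Variable M : lmodType R.
Implicit Types (x : M) (c : nat -> set M).

Local Notation Om := [set N : set M | submod N].

Lemma descending_chain_le c i j :
  descending_chain Om c -> (i <= j)%N -> c j `<=` c i.
Proof.
move=> [_ dc] /subnK <-; elim: (j - i)%N => [|d IH] //.
by apply: subset_trans IH; rewrite -subsetEset; exact: dc.
Qed.

(** * Independent elements along a chain with infinite Artinian factors *)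

Section InfiniteFactors.
Variable c : nat -> set M.
Hypothesis cP : descending_chain Om c.
Hypothesis artc : forall i, minimal_condition (factor Om (c i) (c i.+1)).

Let sc k : submod (c k) := cP.1 k.

(** Induction on [k]: the [a] with [a *: x] in [c k] form an ideal of finite index, and for these
    the line of [a *: x] is finite modulo [c k.+1], as the factor is Artinian. *)
Lemma chain_line_finite x k : c 0 x -> finite_mod (c k) (line x).
Proof.
move=> c0x; elim: k => [|k [s sP]].
  by apply: finite_mod_sub => _ [r _ <-]; exact: submodZ.
apply: (@finite_mod_line R xs gen M _ x [set a : R^o | c k (a *: x)]) => //.
- split; first by rewrite /= scale0r; case: (sc k).
  by move=> a g h; rewrite /= scalerDl -scalerA; case: (sc k) => _; apply.
(* Representatives of the line are lifted to scalars; the default [0] does not occur for a [t] that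
   represents some [a *: x]. *)
- pose rep t := xget 0 [set r : R^o | c k (r *: x - t)].
  exists (map rep s) => a _; have [|t ts at_] := sP (a *: x); first by exists a.
  exists (rep t); first exact: map_f.
  rewrite /= scalerBl -[a *: x](subrK t) -addrA -[t - _]opprB.
  apply: submodB => //.
  by rewrite /rep; case: xgetP => // /(_ a).
- move=> g ckg; apply: (@artinian_line_finite R xs gen M (c k)) => //.
  exact: (descending_chain_le cP).
Qed.

Hypothesis infc : forall i, ~ finite_mod (c i.+1) (c i).

(** Otherwise [c k] would lie in [span s + c k.+1], which is finite modulo [c k.+1]. *)
Lemma chain_avoid k (s : seq M) : (forall y, y \in s -> c 0 y) ->
  exists x, c k x /\ ~ add_set (span s) (c k.+1) x.
Proof.
move=> sc0; apply: contrapT => no; apply: (infc (i := k)).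
apply: (finite_modS (N := add_set (span s) (c k.+1))).
  by move=> x ckx; apply: contrapT => nx; apply: no; exists x.
apply: finite_modD => //; last exact: finite_mod_sub.
by apply: finite_mod_span => // y /sc0; exact: chain_line_finite.
Qed.

Let pick k s := xget 0 [set x | c k x /\ ~ add_set (span s) (c k.+1) x].
(** The list is [x (k-1), ..., x 0]. Thus [Y k] below contains every [x j] with [j <> k]: the
    earlier ones through the span, the later ones through [c k.+1]. *)
Fixpoint chain_choices k : seq M :=
  if k is k'.+1 then pick k' (chain_choices k') :: chain_choices k' else [::].
Let x k := pick k (chain_choices k).
Let Y k := add_set (span (chain_choices k)) (c k.+1).

Lemma chain_choicesP k : c k (x k) /\ ~ Y k (x k).
Proof.
have : forall y, y \in chain_choices k -> c 0 y.
  elim: k => // k IH y; rewrite inE => /orP[/eqP->|/IH//].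
  apply: (descending_chain_le cP (leq0n k)); rewrite /pick; case: xgetP => [_ _ []//|no].
  by have [z /no] := chain_avoid k IH.
move=> /(chain_avoid k) [z zP]; rewrite /x /pick.
by case: xgetP => [_ _ []//|/(_ z)].
Qed.

Let submodY k : submod (Y k).
Proof. by apply: submod_add_set => //; exact: submod_span. Qed.

Let YcS k j : (k < j)%N -> Y k (x j).
Proof.
move=> kj; exists 0; first by case: (submod_span (chain_choices k)).
exists (x j); rewrite ?add0r //; apply: (descending_chain_le cP kj).
by case: (chain_choicesP j).
Qed.

Let Yspan k j : (j < k)%N -> Y k (x j).
Proof.
move=> jk; exists (x j); last by exists 0; rewrite ?addr0//; case: (sc k.+1).
apply: mem_span; elim: k jk => // k IH; rewrite ltnS leq_eqVlt inE.
by move=> /predU1P[->|/IH ->]; rewrite ?eqxx ?orbT.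
Qed.

(** All terms of the relation other than the one at [k] lie in [Y k]. *)
Lemma chain_choices_indep n (r : nat -> R) k : (k < n)%N ->
  \sum_(j < n) r j *: x j = 0 -> Y k (r k *: x k).
Proof.
move=> kn; rewrite (bigD1 (Ordinal kn)) //= => /eqP; rewrite addr_eq0 => /eqP ->.
apply: (submodN (submodY k)); apply: (submod_sum _ (submodY k)) => i.
rewrite -val_eqE /= => ik.
apply: submodZ => //; have [/Yspan//|/YcS//|/eqP] := ltngtP i k.
by rewrite (negPf ik).
Qed.

(* Modulo [partial_span set0] the elements [x k] generate their direct sum. *)
Definition partial_span (Q : set nat) : set M :=
  [set u | exists n (r : nat -> R), (forall j, Q j \/ Y j (r j *: x j)) /\
     u = \sum_(j < n) r j *: x j].

(** Padding with zero coefficients brings two sums to a common length. *)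
Let partial_span_pad Q u : partial_span Q u -> exists n (r : nat -> R),
  (forall j, Q j \/ Y j (r j *: x j)) /\
  forall N, (n <= N)%N -> u = \sum_(j < N) r j *: x j.
Proof.
move=> [n [r [rQ ->]]]; exists n, (fun j => if (j < n)%N then r j else 0).
split=> [j|N nN].
  by case: ifP => // _; right; rewrite scale0r; case: (submodY j).
rewrite (big_ord_widen _ (fun j => r j *: x j) nN) big_mkcond.
by apply: eq_bigr => i _; case: ifP; rewrite ?scale0r.
Qed.

Lemma submod_partial_span Q : submod (partial_span Q).
Proof.
split.
  exists 0, (fun=> 0); rewrite big_ord0; split=> // j.
  by right; rewrite scale0r; case: (submodY j).
move=> a u v /partial_span_pad [n [r [rQ uE]]] /partial_span_pad [m [q [qQ vE]]].
exists (maxn n m), (fun j => a * r j + q j); split=> [j|].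
  have [Qj|rj] := rQ j; first by left.
  have [Qj|qj] := qQ j; [by left|right].
  by rewrite scalerDl -scalerA; case: (submodY j) => _; apply.
rewrite (uE _ (leq_maxl n m)) (vE _ (leq_maxr n m)) scaler_sumr -big_split.
by apply: eq_bigr => i _; rewrite scalerDl scalerA.
Qed.

Lemma partial_spanS Q Q' : Q `<=` Q' -> partial_span Q `<=` partial_span Q'.
Proof.
move=> QQ' u [n [r [rQ uE]]]; exists n, r; split=> // j.
by have [/QQ'|] := rQ j; [left|right].
Qed.

Let sum_delta k n : (k < n)%N -> \sum_(j < n) (j == k :> nat)%:R *: x j = x k.
Proof.
move=> kn; rewrite (bigD1 (Ordinal kn)) //= eqxx scale1r big1 ?addr0 // => i.
by rewrite -val_eqE /= => /negPf ->; rewrite scale0r.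
Qed.

Lemma partial_span_mem Q k : Q k -> partial_span Q (x k).
Proof.
move=> Qk; exists k.+1, (fun j => (j == k)%:R); rewrite sum_delta //; split=> // j.
have [->|_] := eqVneq j k; [by left|right].
by rewrite scale0r; case: (submodY j).
Qed.

(** Subtracting [x k] from its representation gives a relation, so [(r k - 1) *: x k] lies in [Y k].
    As [r k *: x k] does too, [x k] would lie in [Y k]. *)
Lemma partial_span_notin Q k : ~ Q k -> ~ partial_span Q (x k).
Proof.
move=> nQk /partial_span_pad [n [r [rQ xE]]].
have [//|rk] := rQ k; case: (chain_choicesP k) => _; apply.
have kN : (k < maxn n k.+1)%N by exact: leq_maxr.
have := @chain_choices_indep _ (fun j => r j - (j == k)%:R) k kN.
rewrite /= eqxx => /(_ _)/wrap[].
  under eq_bigr do rewrite scalerBl.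
  by rewrite sumrB sum_delta // -(xE _ (leq_maxl _ _)) subrr.
move=> /(submodB (submodY k) rk); congr (Y k _).
by rewrite scalerBl opprB addrCA subrr addr0 scale1r.
Qed.

(** The 2-adic valuation of [k.+1] splits the indices [k] into infinitely many infinite classes. *)
Lemma logn2_cofinal a b : exists2 k, (b <= k)%N & logn 2 k.+1 = a.
Proof.
have p0 : (0 < 2 ^ a * b.*2.+1)%N by rewrite muln_gt0 expn_gt0.
exists (2 ^ a * b.*2.+1).-1; rewrite ?prednK //.
  by rewrite -ltnS prednK //; have := expn_gt0 2 a; nia.
rewrite lognM ?expn_gt0 // pfactorK // logn_coprime ?addn0 //.
by rewrite coprime2n /= odd_double.
Qed.

Lemma infinite_factors_not_artinian : exists2 d : nat -> set M,
  descending_chain Om d &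
  forall a, ~ minimal_condition (factor Om (d a) (d a.+1)).
Proof.
pose Q a : set nat := [set k | (a <= logn 2 k.+1)%N].
exists (partial_span \o Q) => [|a mina].
  split=> a; first exact: submod_partial_span.
  by rewrite subsetEset; apply: partial_spanS => k; exact: ltnW.
(* Between [Q a.+1] and [Q a], the sets [Qb b] discard the indices below [b] of valuation exactly
   [a]. Their spans never become stationary, since each class is infinite. *)
pose Qb b : set nat :=
  [set k | (a < logn 2 k.+1)%N || (b <= k)%N && (a <= logn 2 k.+1)%N].
have [||_ [b _ <-] minb] := mina (range (partial_span \o Qb)).
- move=> _ [b _ <-]; split; first exact: submod_partial_span.
  apply/andP; split; rewrite subsetEset; apply: partial_spanS => k /=; rewrite /Q /Qb /=.
    by move=> ->.
  by move=> /orP[/ltnW//|/andP[]].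
- by exists (partial_span (Qb 0)), 0.
have [k bk ak] := logn2_cofinal a b.
apply: (@partial_span_notin (Qb k.+1) k).
  by rewrite /Qb /= ak ltnn ltnn.
have -> : partial_span (Qb k.+1) = partial_span (Qb b).
  apply: minb; first by exists k.+1.
  rewrite subsetEset; apply: partial_spanS => j /orP[aj|/andP[kj aj]].
    by rewrite /Qb /= aj.
  by rewrite /Qb /= aj (leq_trans bk (ltnW kj)) orbT.
by apply: partial_span_mem; rewrite /Qb /= ak leqnn bk orbT.
Qed.

End InfiniteFactors.

Theorem submod_chain_finite :
  (forall c, descending_chain Om c ->
     finite_set [set i | ~ minimal_condition (factor Om (c i) (c i.+1))]) ->
  forall c, descending_chain Om c ->
    finite_set [set i | ~ finite_mod (c i.+1) (c i)].
Proof.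
move=> H c cP; apply: contrapT => infB.
have big n : exists2 i, (n <= i)%N & ~ finite_mod (c i.+1) (c i).
  apply: contrapT => no; apply: infB; apply: sub_finite_set (finite_II n) => i inf.
  by rewrite /= ltnNge; apply/negP => ni; apply: no; exists i.
(* [e] picks increasing indices of infinite factors; by [big] the default [0] is never taken for
   lack of a witness. *)
pose e := fix e n :=
  if n is m.+1 then
    xget 0%N [set i | (e m < i)%N /\ ~ finite_mod (c i.+1) (c i)]
  else xget 0%N [set i | ~ finite_mod (c i.+1) (c i)].
have eP n : (e n < e n.+1)%N /\ ~ finite_mod (c (e n).+1) (c (e n)).
  have eS m : (e m < e m.+1)%N /\ ~ finite_mod (c (e m.+1).+1) (c (e m.+1)).
    rewrite /=; case: xgetP => // no.
    by have [i mi infi] := big (e m).+1; have := no i; case.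
  split; first by case: (eS n).
  case: n => [|n]; last by case: (eS n).
  by rewrite /=; case: xgetP => // no; have [i _ infi] := big 0; have := no i; case.
have dcP : descending_chain Om (c \o e).
  split=> i; first exact: cP.1.
  by rewrite subsetEset; apply: (descending_chain_le cP); case: (eP i) => /ltnW.
(* A factor of the subchain may merge several factors of [c], so the hypothesis is applied to the
   subchain itself. *)
have [m mP] : exists m, forall i, (m <= i)%N ->
    minimal_condition (factor Om (c (e i)) (c (e i.+1))).
  have [m mP] := finite_nat_bound (H _ dcP); exists m => i /mP.
  exact: contrapT.
pose d i := c (e (m + i)%N).
have [||| f fP] := @infinite_factors_not_artinian d.
- split=> i; rewrite /d; first exact: cP.1.
  by rewrite addnS; exact: (dcP.2 (m + i)%N).
- by move=> i; rewrite /d addnS; apply: mP; exact: leq_addr.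
(* The merged factor maps onto the infinite factor at its top. *)
- move=> i; rewrite /d addnS => fin; case: (eP (m + i)%N) => lte [].
  have [s sP] := fin; exists s => u /sP [t ts ut]; exists t => //.
  exact: (descending_chain_le cP lte) ut.
move=> nf; have := H f fP.
rewrite (_ : [set i | _] = setT); first exact: infinite_nat.
by apply/seteqP; split=> // i _; exact: nf.
Qed.

End ArtinianFactors.

(** * Abelian groups with commuting operators *)

Section OperatorRing.
Variable V : zmodType.

(** Bundling the maps with their properties lets the operator ring and its module be declared as
    structures indexed by the bundle. Nontriviality of [V] ensures [1 != 0] in that ring. *)
Record operators := Operators {
  ops :> seq (V -> V);
  opsB : forall b, b \in ops -> {morph b : u v / u - v};
  ops_comm : forall b b', b \in ops -> b' \in ops -> b \o b' =1 b' \o b;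
  ops_nontrivial : exists v : V, v != 0
}.

Variable B : operators.

Inductive op_generated : (V -> V) -> Prop :=
| op_id : op_generated id
| op_gen b : b \in ops B -> op_generated b
| op_sub f g : op_generated f -> op_generated g -> op_generated (f - g)
| op_comp f g : op_generated f -> op_generated g -> op_generated (f \o g).

Definition op_pred : {pred V -> V} := [pred f | `[<op_generated f>]].

Lemma op_predP f : reflect (op_generated f) (f \in op_pred).
Proof. exact: asboolP. Qed.

Lemma op_pred_zmod : zmod_closed op_pred.
Proof.
split=> [|f g /op_predP gf /op_predP gg]; apply/op_predP; last exact: op_sub.
by rewrite -(subrr id); apply: op_sub; exact: op_id.
Qed.

HB.instance Definition _ := GRing.isZmodClosed.Build (V -> V) op_pred op_pred_zmod.

Record op := Op { op_fun :> V -> V; op_funP : op_fun \in op_pred }.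
HB.instance Definition _ := [isSub for op_fun].
HB.instance Definition _ := [Choice of op by <:].
HB.instance Definition _ := [SubChoice_isSubZmodule of op by <:].

Lemma opB (f : op) : {morph f : u v / u - v}.
Proof.
case: f => f /op_predP /=; elim=> {f} [//|b /opsB //|f g _ fB _ gB|f g _ fB _ gB] u v /=.
  by rewrite !fctE fB gB !opprD addrACA.
by rewrite gB fB.
Qed.

Lemma op0 (f : op) : f 0 = 0.
Proof. by rewrite -(subrr 0) opB !subrr. Qed.

Lemma opN (f : op) : {morph f : u / - u}.
Proof. by move=> u; rewrite -[- u]sub0r opB op0 sub0r. Qed.

Lemma opD (f : op) : {morph f : u v / u + v}.
Proof. by move=> u v; rewrite -{1}[v]opprK opB opN opprK. Qed.

Lemma op_commute (f g : op) : f \o g =1 g \o f.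
Proof.
have comm_gen h b : h \in op_pred -> b \in ops B -> h \o b =1 b \o h.
  move=> /op_predP + bB; elim=> {h} [//|b' b'B|h k _ hb _ kb|h k _ hb _ kb] v /=.
  - exact: (ops_comm b'B bB v).
  - by rewrite !fctE (opsB bB); congr (_ - _); [exact: hb|exact: kb].
  - by rewrite -[RHS]hb /=; congr h; exact: kb.
case: g => g /op_predP /=; elim=> {g} [//|b bB|h k _ fh _ fk|h k _ fh _ fk] v /=.
- exact: (comm_gen f b (op_funP f) bB v).
- by rewrite !fctE opB; congr (_ - _); [exact: fh|exact: fk].
- by rewrite [LHS]fh /=; congr h; exact: fk.
Qed.

Definition op_one := Op (introT (op_predP _) op_id).
Definition op_mul (f g : op) :=
  Op (introT (op_predP _)
    (op_comp (elimT (op_predP _) (op_funP f)) (elimT (op_predP _) (op_funP g)))).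

Lemma op_mulA : associative op_mul.
Proof. by move=> f g h; exact: val_inj. Qed.

Lemma op_mulC : commutative op_mul.
Proof. by move=> f g; apply: val_inj; apply: funext => v; exact: op_commute. Qed.

Lemma op_mul1 : left_id op_one op_mul.
Proof. by move=> f; exact: val_inj. Qed.

Lemma op_mulDl : left_distributive op_mul +%R.
Proof. by move=> f g h; exact: val_inj. Qed.

Lemma op_one_neq0 : op_one != 0.
Proof.
have [v v0] := ops_nontrivial B; apply/eqP => /(congr1 (fun f : op => f v)) /=.
by apply/eqP.
Qed.

HB.instance Definition _ := GRing.Zmodule_isComNzRing.Build op
  op_mulA op_mulC op_mul1 op_mulDl op_one_neq0.

Lemma op_ring_generated : ring_generated (pmap insub (ops B) : seq op).
Proof.
move=> S [S1 SB SM] Sgen [f fP].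
have := fP; move/op_predP => fg.
elim: fg fP => {f} [|b bB|f g gf Sf gg Sg|f g gf Sf gg Sg] fP.
- by rewrite (_ : Op fP = 1) //; exact: val_inj.
- by apply: Sgen; rewrite mem_pmap_sub.
- have fP' : f \in op_pred by exact/op_predP.
  have gP' : g \in op_pred by exact/op_predP.
  rewrite (_ : Op fP = Op fP' - Op gP'); first by apply: SB; [exact: Sf|exact: Sg].
  exact: val_inj.
- have fP' : f \in op_pred by exact/op_predP.
  have gP' : g \in op_pred by exact/op_predP.
  rewrite (_ : Op fP = Op fP' * Op gP'); first by apply: SM; [exact: Sf|exact: Sg].
  exact: val_inj.
Qed.

(** An alias of [V] that remembers [B], to carry the scalar action of [op B]. *)
Definition opmod of operators : Type := V.
Local Notation M := (opmod B).
HB.instance Definition _ := GRing.Zmodule.copy M V.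

Definition op_scale (f : op) (v : M) : M := f v.

Lemma op_scaleA (f g : op) v : op_scale f (op_scale g v) = op_scale (f * g) v.
Proof. by []. Qed.
Lemma op_scale1 : left_id 1 op_scale. Proof. by []. Qed.
Lemma op_scaleDr : right_distributive op_scale +%R.
Proof. by move=> f u v; exact: opD. Qed.
Lemma op_scaleDl v : {morph op_scale^~ v : f g / f + g}.
Proof. by []. Qed.

HB.instance Definition _ := GRing.Zmodule_isLmodule.Build op M
  op_scaleA op_scale1 op_scaleDr op_scaleDl.

Definition stable (bs : seq (V -> V)) (N : set V) : Prop :=
  [/\ N 0, forall u v, N u -> N v -> N (u - v)
    & forall b, b \in bs -> forall u, N u -> N (b u)].

Lemma submod_opE (N : set M) : submod N <-> stable (ops B) N.
Proof.
split=> [sN|[N0 NB Nb]].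
  split=> [|u v|b bB u Nu]; [by case: sN|exact: (@submodB _ M)|].
  by apply: (submodZ (Op (introT (op_predP _) (op_gen bB))) sN Nu).
split=> // -[f fP] u v Nu Nv.
have Nf : N (f u).
  move: fP => /op_predP fg.
  elim: fg u Nu => {f} [//|b bB|f g _ Nf _ Ng|f g _ Nf _ Ng] u Nu.
  - exact: Nb.
  - by apply: NB; [exact: Nf|exact: Ng].
  - exact/Nf/Ng.
have := NB _ _ Nf (NB _ _ N0 Nv); rewrite sub0r opprK; exact.
Qed.

End OperatorRing.

Theorem stable_chain_finite (V : zmodType) (bs : seq (V -> V)) :
  (forall b, b \in bs -> {morph b : u v / u - v}) ->
  (forall b b', b \in bs -> b' \in bs -> b \o b' =1 b' \o b) ->
  (forall c, descending_chain [set N | stable bs N] c -> finite_set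
     [set i | ~ minimal_condition (factor [set N | stable bs N] (c i) (c i.+1))]) ->
  forall c, descending_chain [set N | stable bs N] c ->
    finite_set [set i | ~ finite_mod (c i.+1) (c i)].
Proof.
move=> bsB bs_comm H c cP.
(* A zero group is treated apart, as its operator ring would be the zero ring. *)
have [ntV|tV] := pselect (exists v : V, v != 0); last first.
  apply: (@sub_finite_set _ _ set0) => // i; apply; exists [:: 0] => u _.
  exists 0; first exact: mem_head.
  have -> : u = 0 by apply: contrapT => u0; apply: tV; exists u; apply/eqP.
  by rewrite subr0; case: (cP.1 i.+1).
pose B := Operators bsB bs_comm ntV.
have OmE : [set N | stable bs N] = [set N : set (opmod B) | submod N].
  by apply/seteqP; split=> N /(submod_opE (B := B)).
rewrite OmE in H cP.
exact: (@submod_chain_finite (op B) _ (@op_ring_generated _ B) (opmod B) H c cP).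
Qed.

(** * Normal subgroups *)

(** This will be applied with [Phi] sending submodules of [A], or subgroups of [B], to normal
    subgroups of [G]. *)
Lemma minimal_condition_transfer (d d' : Order.disp_t) (P : porderType d)
    (P' : porderType d') (Om : set P) (Om' : set P') (Phi : P -> P') (a b : P) :
  (forall N, Om N -> Om' (Phi N)) -> {homo Phi : x y / (x <= y)%O} ->
  injective Phi -> minimal_condition (factor Om' (Phi a) (Phi b)) ->
  minimal_condition (factor Om a b).
Proof.
move=> PhiOm Phile Phi_inj min S SOm [x Sx].
have [||_ [m Sm <-] mP] := min (Phi @` S).
- move=> _ [y /SOm [Omy /andP[byle yale]] <-]; split; first exact: PhiOm.
  by rewrite !Phile.
- by exists (Phi x), x.
by exists m => // y Sy ym; apply/Phi_inj/mP; [exists y|exact: Phile].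
Qed.

Lemma finite_non_minimal_transfer (d d' : Order.disp_t) (P : porderType d)
    (P' : porderType d') (Om : set P) (Om' : set P') (Phi : P -> P') :
  (forall N, Om N -> Om' (Phi N)) -> {homo Phi : x y / (x <= y)%O} ->
  injective Phi ->
  (forall c, descending_chain Om' c -> finite_set
     [set i | ~ minimal_condition (factor Om' (c i) (c i.+1))]) ->
  forall c, descending_chain Om c -> finite_set
     [set i | ~ minimal_condition (factor Om (c i) (c i.+1))].
Proof.
move=> PhiOm Phile Phi_inj fin c [cOm cle].
apply: sub_finite_set (fin (Phi \o c) _) => [i nmin min|].
  exact/nmin/(minimal_condition_transfer PhiOm).
by split=> i /=; [exact: PhiOm|exact: Phile].
Qed.

Section Groups.
Variable G : groupType.
Local Open Scope group_scope.

Local Notation normals := [set N : set G | normal_subgroup N].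

Lemma trivial_poset_minimal (d : Order.disp_t) (P : porderType d) (Om : set P) :
  trivial_poset Om -> minimal_condition Om.
Proof. by move=> tr S SOm [x Sx]; exists x => // y Sy; apply: tr; exact: SOm. Qed.

Lemma deviation0_minimal (d : Order.disp_t) (P : porderType d) (Om : set P) :
  deviation nat_wf (Some 0%N) Om -> minimal_condition Om.
Proof. by move=> /deviationE[[_ []//]|[[]]]. Qed.

Lemma minimal_condition_factor (d : Order.disp_t) (P : porderType d)
    (Om : set P) a b :
  minimal_condition Om -> minimal_condition (factor Om a b).
Proof. by move=> min S SOm; apply: min => x /SOm []. Qed.

(** Deviation [-1] or [0] gives the minimal condition outright; in deviation [1], all but finitely
    many factors have deviation [-1] or [0]. *)
Lemma krull_dimension_le1_minimal : krull_dimension_le G 1 ->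
  forall c, descending_chain normals c -> finite_set
    [set i | ~ minimal_condition (factor normals (c i) (c i.+1))].
Proof.
move=> [d devG dle] c cP.
have fin0 : minimal_condition normals -> finite_set
    [set i | ~ minimal_condition (factor normals (c i) (c i.+1))].
  move=> min; apply: (@sub_finite_set _ _ set0) => // i; apply.
  exact: minimal_condition_factor.
case: d devG dle => [[|[|n]]|] devG; last by move=> _; apply/fin0/trivial_poset_minimal.
- by move=> _; apply/fin0/deviation0_minimal.
- move=> _; move: devG => /deviationE[[_ [_ //]]|[_ [_ /(_ c cP)]]].
  apply: sub_finite_set => i nmin [[[|n]|] //= _]; last first.
    by move/trivial_poset_minimal.
  by move/deviation0_minimal.
- by case=> [[]|/=]; rewrite ?ltEnat.
Qed.

Section NormalSubgroup.
Variable N : set G.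
Hypothesis nN : normal_subgroup N.

Lemma normal1 : N 1. Proof. by case: nN => -[]. Qed.
Lemma normalF x y : N x -> N y -> N (x / y). Proof. by case: nN => -[_ +] _; apply. Qed.
Lemma normalV x : N x -> N x^-1.
Proof. by move=> Nx; rewrite -div1g; apply: normalF => //; exact: normal1. Qed.
Lemma normalM x y : N x -> N y -> N (x * y).
Proof. by move=> Nx /normalV Ny; rewrite -[y]invgK; exact: normalF. Qed.
Lemma normalJ x y : N x -> N (x ^ y). Proof. by case: nN => _; apply. Qed.

End NormalSubgroup.

(** * The normal subgroup [A] as a module under conjugation *)

Section AbelianNormal.
Variables (A : set G) (nA : normal_subgroup A) (abA : abelian A).

Definition elt_pred (S : set G) : {pred G} := [pred x | `[<S x>]].

Record elt (nA : normal_subgroup A) (abA : abelian A) :=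
  Elt { elt_val :> G; elt_valP : elt_val \in elt_pred A }.
Local Notation T := (elt nA abA).
HB.instance Definition _ := [isSub for @elt_val nA abA].
HB.instance Definition _ := [Choice of T by <:].

Lemma eltP (u : T) : A u. Proof. exact/asboolP/elt_valP. Qed.

Definition to_elt x (Ax : A x) : T := Elt nA abA (introT (asboolP _) Ax).

Definition elt_zero := to_elt (normal1 nA).
Definition elt_opp (u : T) := to_elt (normalV nA (eltP u)).
Definition elt_add (u v : T) := to_elt (normalM nA (eltP u) (eltP v)).

Lemma elt_addA : associative elt_add.
Proof. by move=> u v w; apply: val_inj => /=; rewrite mulgA. Qed.
Lemma elt_addC : commutative elt_add.
Proof. by move=> u v; apply: val_inj; apply: abA; exact: eltP. Qed.
Lemma elt_add0 : left_id elt_zero elt_add.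
Proof. by move=> u; apply: val_inj => /=; rewrite mul1g. Qed.
Lemma elt_addN : left_inverse elt_zero elt_opp elt_add.
Proof. by move=> u; apply: val_inj => /=; rewrite mulVg. Qed.

HB.instance Definition _ := GRing.isZmodule.Build T
  elt_addA elt_addC elt_add0 elt_addN.

Definition elt_conj (g : G) (u : T) : T := to_elt (normalJ nA g (eltP u)).

Lemma elt_conjB g : {morph elt_conj g : u v / (u - v)%R}.
Proof. by move=> u v; apply: val_inj => /=; rewrite conjMg conjVg. Qed.

Lemma elt_conj1 : elt_conj 1 =1 id.
Proof. by move=> u; apply: val_inj; rewrite /= conjg1. Qed.

Lemma elt_conjM g h : elt_conj (g * h) =1 elt_conj h \o elt_conj g.
Proof. by move=> u; apply: val_inj; rewrite /= conjgM. Qed.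

(** [A] is abelian and so acts trivially on itself: the conjugation action factors through [B]. *)
Lemma elt_conj_coset g h :
  quot_proj nA g = quot_proj nA h -> elt_conj g =1 elt_conj h.
Proof.
move=> /quot_projP Agh u; rewrite -[h](mulVKg g) elt_conjM /=.
apply: val_inj => /=; rewrite [RHS]conjgE.
have := abA Agh (normalJ nA g (eltP u)).
by rewrite /commute => <-; rewrite mulKg.
Qed.

Lemma quot_projM x y : quot_proj nA (x * y) = quot_proj nA x * quot_proj nA y.
Proof. by rewrite -quot_mulE. Qed.

Lemma quot_projV x : quot_proj nA x^-1 = (quot_proj nA x)^-1.
Proof. by rewrite -quot_invE. Qed.

Hypothesis abB : abelian [set: quotient_group nA]%classic.

Lemma quot_projC x y : quot_proj nA (x * y) = quot_proj nA (y * x).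
Proof. by rewrite !quot_projM; exact: abB. Qed.

(** Inverses are included because a subgroup mapped into itself by conjugation with [g] need not be
    so by [g^-1]. *)
Definition conj_ops (s : seq (quotient_group nA)) : seq (T -> T) :=
  [seq elt_conj (repr q) | q <- s] ++ [seq elt_conj (repr q)^-1 | q <- s].

Lemma conj_opsP s b : b \in conj_ops s -> exists g, b = elt_conj g.
Proof.
by rewrite mem_cat => /orP[] /mapP[q _ ->]; [exists (repr q)|exists (repr q)^-1].
Qed.

Lemma conj_opsB s b : b \in conj_ops s -> {morph b : u v / (u - v)%R}.
Proof. by move=> /conj_opsP[g ->]; exact: elt_conjB. Qed.

Lemma conj_ops_comm s b b' :
  b \in conj_ops s -> b' \in conj_ops s -> b \o b' =1 b' \o b.
Proof.
move=> /conj_opsP[g ->] /conj_opsP[h ->] u.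
by rewrite -!elt_conjM; apply: elt_conj_coset; exact: quot_projC.
Qed.

Lemma normal_stable bs (N : set G) :
  (forall b, b \in bs -> exists g, b = elt_conj g) ->
  normal_subgroup N -> stable bs [set u : T | N u].
Proof.
move=> bsP nN; split; first exact: (normal1 nN).
  by move=> u v; exact: (normalF nN).
by move=> b /bsP[g ->] u; exact: (normalJ nN).
Qed.

Lemma stable_normal s (N : set T) :
  generated [set` s] = [set: quotient_group nA]%classic ->
  stable (conj_ops s) N -> normal_subgroup [set elt_val u | u in N].
Proof.
move=> gens [N0 NB Nb].
(* The cosets that preserve [N] together with their inverses form a subgroup of [B] containing
   [s]. *)
pose Z : set (quotient_group nA) := [set q | forall g, quot_proj nA g = q ->
  forall u, N u -> N (elt_conj g u) /\ N (elt_conj g^-1 u)].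
have ZT : [set: quotient_group nA]%classic `<=` Z.
  rewrite -gens; apply: smallest_sub.
    split=> [g g1 u Nu|p q Zp Zq g gE u Nu].
      have gV : quot_proj nA g^-1 = quot_proj nA 1.
        by rewrite quot_projV g1; exact: invg1.
      by rewrite (elt_conj_coset g1) (elt_conj_coset gV) elt_conj1.
    have rp := quot_reprK p; have rq := quot_reprK q.
    have gE' : quot_proj nA g = quot_proj nA (repr p * (repr q)^-1).
      by rewrite quot_projM quot_projV rp rq.
    have gV : quot_proj nA g^-1 = quot_proj nA (repr q * (repr p)^-1).
      by rewrite quot_projV gE' -quot_projV invgM invgK.
    rewrite (elt_conj_coset gE') (elt_conj_coset gV) !elt_conjM /=.
    by split; [apply: (Zq _ rq _ _).2; apply: (Zp _ rp _ Nu).1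
      |apply: (Zp _ rp _ _).2; apply: (Zq _ rq _ Nu).1].
  move=> q qs g gq u Nu.
  have gE : quot_proj nA g = quot_proj nA (repr q) by rewrite quot_reprK.
  have gV : quot_proj nA g^-1 = quot_proj nA (repr q)^-1.
    by rewrite !quot_projV gE.
  rewrite (elt_conj_coset gE) (elt_conj_coset gV).
  split; apply: Nb => //; rewrite mem_cat; apply/orP; [left|right];
    by apply/mapP; exists q.
split; first split.
- by exists 0%R.
- by move=> _ _ [u Nu <-] [v Nv <-]; exists (u - v)%R; [exact: NB|].
- move=> _ g [u Nu <-]; exists (elt_conj g u) => //.
  by have [] := ZT (quot_proj nA g) I g erefl u Nu.
Qed.

Lemma subgroup_chain_finite (s : seq (quotient_group nA)) (H : nat -> set G) :
  generated [set` s] = [set: quotient_group nA]%classic ->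
  krull_dimension_le G 1 -> descending_chain normals H ->
  finite_set [set i | ~ finite_mod [set u : T | H i.+1 u] [set u : T | H i u]].
Proof.
move=> gens KG [Hn Hle].
apply: (@stable_chain_finite T (conj_ops s) _ _ _ (fun i => [set u : T | H i u])).
- exact: conj_opsB.
- exact: conj_ops_comm.
- apply: (@finite_non_minimal_transfer _ _ _ _ _ normals
    (fun N : set T => [set elt_val u | u in N])).
  + by move=> N; exact: stable_normal.
  + by move=> N N'; rewrite !subsetEset => NN'; exact: image_subset.
  + move=> N N' NN'; rewrite predeqE => u.
    have imE (S : set T) : [set elt_val v | v in S] (elt_val u) = S u.
      exact: image_inj val_inj.
    by rewrite -imE NN' imE.
  + exact: krull_dimension_le1_minimal.
split=> i; first by apply: normal_stable; [exact: conj_opsP|exact: Hn].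
by have := Hle i; rewrite !subsetEset => HH u; exact: HH.
Qed.

(** * The quotient [B] as an additive group *)

Definition abelian_quotient of abelian [set: quotient_group nA]%classic : Type :=
  quotient_group nA.
Local Notation B := (abelian_quotient abB).
HB.instance Definition _ := Choice.on B.

Lemma quot_mulC : commutative (@quot_mul G A nA).
Proof. by move=> p q; exact: abB. Qed.

HB.instance Definition _ := GRing.isZmodule.Build B
  (@quot_mulA G A nA) quot_mulC (@quot_mul1 G A nA) (@quot_mulV G A nA).

(** As [B] is abelian, [x ^ g] and [x] have the same image in it. *)
Lemma stable_preimage_normal (N : set B) :
  stable [::] N -> normal_subgroup (quot_proj nA @^-1` N).
Proof.
move=> [N0 NB _]; split; first split=> //.
  by move=> x y Nx Ny; rewrite /preimage /= quot_projM quot_projV; exact: NB.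
move=> x g Nx; rewrite /preimage /= conjgE quot_projC mulgK.
exact: Nx.
Qed.

Lemma quotient_chain_finite (H : nat -> set G) :
  krull_dimension_le G 1 -> descending_chain normals H ->
  finite_set [set i | ~ finite_mod ((quot_proj nA @` H i.+1) : set B)
                                   (quot_proj nA @` H i)].
Proof.
move=> KG [Hn Hle].
(* With no operators the stable sets are exactly the subgroups of [B]. *)
apply: (@stable_chain_finite B [::] _ _ _ (fun i => quot_proj nA @` H i)) => //.
- apply: (@finite_non_minimal_transfer _ _ _ _ _ normals
    (fun N : set B => quot_proj nA @^-1` N)).
  + by move=> N; exact: stable_preimage_normal.
  + by move=> N N'; rewrite !subsetEset => NN'; exact: preimage_subset.
  + move=> N N' NN'; rewrite predeqE => q; rewrite -[q]quot_reprK.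
    have : (quot_proj nA @^-1` N) (repr q) = (quot_proj nA @^-1` N') (repr q).
      by rewrite NN'.
    by rewrite /preimage /= => ->.
  + exact: krull_dimension_le1_minimal.
split=> i; last first.
  by have := Hle i; rewrite !subsetEset => HH; exact: image_subset.
split=> //; first by exists 1; first exact: (normal1 (Hn i)).
move=> _ _ [x Hx <-] [y Hy <-]; exists (x / y); first exact: (normalF (Hn i)).
by rewrite quot_projM quot_projV.
Qed.

Lemma coset_eq (K : set G) (x y : G) : normal_subgroup K -> K (x^-1 * y) ->
  [set x * k | k in K] = [set y * k | k in K].
Proof.
move=> nK Kxy; apply/seteqP; split=> _ [k Kk <-].
  exists ((x^-1 * y)^-1 * k); first by apply: normalM => //; exact: normalV.
  by rewrite invgM invgK !mulgA mulgV mul1g.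
by exists (x^-1 * y * k); [exact: normalM|rewrite !mulgA mulgV mul1g].
Qed.

(* The modular law: H/K is covered by H/(K(H \cap A)) and (H \cap A)/(K \cap A). *)
Lemma finite_index_extension (H K : set G) :
  normal_subgroup H -> normal_subgroup K -> K `<=` H ->
  finite_mod [set u : T | K u] [set u : T | H u] ->
  finite_mod ((quot_proj nA @` K) : set B) (quot_proj nA @` H) ->
  finite_index H K.
Proof.
move=> nH nK KH [s sP] [t tP].
(* Representatives modulo the image of [K] are lifted into [H]; the default [1] is avoided whenever
   [q] represents an element of [H]. *)
pose rep (q : B) := xget 1 [set h |
  H h /\ (quot_proj nA @` K) ((quot_proj nA h : B) - q)%R].
apply: (@sub_finite_set _ _ [set [set h * k | k in K] |
    h in [set rep q * u | q in [set` t] & u in [set elt_val u | u in [set` s]]]]); last first.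
  by apply/finite_image/finite_image2; [|apply: finite_image]; exact: finite_seq.
move=> _ [h Hh <-].
have [|q qt hq] := tP (quot_proj nA h : B); first by exists h.
have [Hr rq] : H (rep q) /\ (quot_proj nA @` K) ((quot_proj nA (rep q) : B) - q)%R.
  by rewrite /rep; case: xgetP => // /(_ h)[].
have [k Kk kE] : exists2 k, K k & quot_proj nA k = quot_proj nA ((rep q)^-1 * h).
  move: hq rq => [k1 Kk1 k1E] [k2 Kk2 k2E].
  exists (k1 / k2); first exact: normalF.
  have -> : quot_proj nA (k1 / k2) = ((quot_proj nA k1 : B) - (quot_proj nA k2 : B))%R.
    by rewrite quot_projM quot_projV.
  rewrite k1E k2E opprB addrA subrK addrC.
  by rewrite quot_projM quot_projV.
have Aa : A (k^-1 * ((rep q)^-1 * h)) by apply/quot_projP.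
have Ha : H (k^-1 * ((rep q)^-1 * h)).
  by do 2?[apply: normalM => //; first by apply: normalV => //; apply: KH].
(* Conjugating by [k^-1] moves [k] to the right, so that [h = rep q * u' * k] with [u'] in [A] and
   in [H]. *)
pose u' := to_elt (normalJ nA k^-1 Aa).
have [|u us Ku] := sP u'; first exact: normalJ.
exists (rep q * elt_val u); first by exists q => //; exists (elt_val u) => //; exists u.
apply: coset_eq => //.
have -> : (rep q * elt_val u)^-1 * h = ((elt_val u' / elt_val u) ^ elt_val u) * k.
  rewrite /u' /= !conjgE invgM invgK -!mulgA.
  by rewrite mulVKg mulKg mulVg mulg1.
by apply: normalM => //; exact: (normalJ nK).
Qed.

End AbelianNormal.

End Groups.

Theorem proposition3p6 (G : groupType) (metabG : metabelian G)
    (A : set G) (nA : normal_subgroup A) (abA : abelian A)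
    (abB : abelian [set: quotient_group nA]%classic)
    (fgB : finitely_generated (quotient_group nA))
    (KG : krull_dimension_le G 1) :
  weak_min_normal G.
Proof.
have [s gens] := fgB; move=> H Hn Hle.
have cH : descending_chain [set N : set G | normal_subgroup N] H.
  by split=> // i; rewrite subsetEset; exact: Hle.
have finA := subgroup_chain_finite abA abB gens KG cH.
have finB := quotient_chain_finite abB KG cH.
apply: sub_finite_set (_ : finite_set (_ `|` _)); last first.
  by rewrite finite_setU; split; [exact: finA|exact: finB].
move=> i /= ninf; apply: contrapT => /not_orP[/contrapT fA /contrapT fB].
by apply: ninf; exact: finite_index_extension (Hn i) (Hn i.+1) (Hle i) fA fB.
Qed.
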